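(* Let $\lambda\in\mathbb{R}$, and on $\mathbb{R}_{>0}^2$ with coordinates $(x,y)$ consider the open subset where $\det(h_\lambda)\neq0$ and $\mu_\lambda=\operatorname{tr}(A_\lambda)\neq0$. On this set the projector $P_\lambda=\mu_\lambda^{-1}A_\lambda$ is given by $$P_\lambda(X)=\frac{\omega(X)}{\omega(V_\lambda)}\,V_\lambda,\qquad V_\lambda=h_\lambda^{-1}\omega,\qquad \omega=\frac{dx}{x}-\frac{dy}{y}.$$ Moreover, $$\operatorname{im}(P_\lambda)=\operatorname{span}\{V_\lambda\},\qquad \ker(P_\lambda)=\ker\omega.$$ In particular, $\ker(P_\lambda)$ is generated by $x\partial_x+y\partial_y$.
   Context: Let $J(s)=\frac12(s+s^{-1})-1$ for $s>0$ and $\Phi_\lambda(x,y)=J(x)+J(y)+\lambda J(x/y)$. The symmetric tensor $h_\lambda$ has as matrix in the frame $(\partial_x,\partial_y)$ the Hessian matrix of $\Phi_\lambda$ in the $(x,y)$-coordinates, namely $\begin{pmatrix}a&b\\ b&d\end{pmatrix}$ with $a=\frac{1+\lambda y}{x^3}$, $b=-\lambda\frac{x^2+y^2}{2x^2y^2}$, $d=\frac{1+\lambda x}{y^3}$. The rank-one tensor is $\tilde g=\frac{x^2+y^2}{2xy}\,\omega\otimes\omega$. The $(1,1)$-tensor $A_\lambda=h_\lambda^{-1}\tilde g$ is defined by $h_\lambda(A_\lambda X,Y)=\tilde g(X,Y)$ for all $X,Y$, and $V_\lambda=h_\lambda^{-1}\omega$ is the vector field defined by $h_\lambda(V_\lambda,X)=\omega(X)$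 for all $X$. *)

(* Defs.v *)
From HB Require Import structures.
From mathcomp Require Import all_boot all_order all_algebra.
From mathcomp Require Import all_classical all_reals all_analysis.
From mathcomp Require Import ring lra.

Set Implicit Arguments.
Unset Strict Implicit.
Unset Printing Implicit Defensive.

Import Order.TTheory GRing.Theory Num.Theory.
Import numFieldNormedType.Exports.

Local Open Scope classical_set_scope.
Local Open Scope ring_scope.

(* A tangent vector at p is the column of its components in the frame
   (d/dx, d/dy); a covector is the row of its components in (dx, dy).  A
   (0,2)-tensor is its Gram matrix in this frame, and a (1,1)-tensor is the
   matrix by which it acts on columns.  Tensor fields are functions of the
   point p = (x, y); only their values for x, y > 0 are meaningful. *)

Section Tensors.
Context {R : realType}.
Implicit Types (l : R) (f : R * R -> R) (p : R * R).
Implicit Types (B : 'M[R]_2) (w : 'rV[R]_2) (X Y : 'cV[R]_2).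

Definition covec (a b : R) : 'rV[R]_2 := \row_(j < 2) (if j == 0 then a else b).
Definition vec (a b : R) : 'cV[R]_2 := \col_(i < 2) (if i == 0 then a else b).

Definition pairing w X : R := (w *m X) 0 0.
Definition bilin B X Y : R := (X^T *m B *m Y) 0 0.

Definition partial (i : 'I_2) f p : R :=
  if i == 0 then derive1 (fun t : R => f (t, p.2)) p.1
  else derive1 (fun t : R => f (p.1, t)) p.2.

Definition hessian f p : 'M[R]_2 :=
  \matrix_(i < 2, j < 2) partial i (partial j f) p.

Definition J (s : R) : R := 2^-1 * (s + s^-1) - 1.

Definition Phi l p : R := J p.1 + J p.2 + l * J (p.1 / p.2).

Definition h l p : 'M[R]_2 := hessian (Phi l) p.

Definition omega p : 'rV[R]_2 := covec p.1^-1 (- p.2^-1).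

Definition gtilde p : 'M[R]_2 :=
  ((p.1 ^+ 2 + p.2 ^+ 2) / (2 * p.1 * p.2)) *: ((omega p)^T *m omega p).

(* See A_defining and V_defining below: where h l p is nondegenerate, these are
   the unique solutions of h (A X, Y) = gtilde (X, Y) and h (V, X) = omega X. *)
Definition A l p : 'M[R]_2 := invmx (h l p) *m gtilde p.
Definition V l p : 'cV[R]_2 := invmx (h l p) *m (omega p)^T.

Definition mu l p : R := \tr (A l p).

Definition P l p : 'M[R]_2 := (mu l p)^-1 *: A l p.

Definition euler p : 'cV[R]_2 := vec p.1 p.2.

Definition domain l : set (R * R) :=
  [set p | [/\ 0 < p.1, 0 < p.2, \det (h l p) != 0 & mu l p != 0]].

Definition h_explicit l p : 'M[R]_2 :=
  let: (x, y) := p in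
  let a := (1 + l * y) / x ^+ 3 in
  let b := - l * ((x ^+ 2 + y ^+ 2) / (2 * x ^+ 2 * y ^+ 2)) in
  let d := (1 + l * x) / y ^+ 3 in
  \matrix_(i < 2, j < 2)
    (if i == 0 then if j == 0 then a else b else if j == 0 then b else d).

Lemma derive1_near (f g : R -> R) (t : R) :
  0 < t -> (forall s, 0 < s -> f s = g s) -> derive1 f t = derive1 g t.
Proof.
move=> t0 fg; rewrite !derive1E; apply: near_eq_derive => //.
by near=> s; apply: fg; near: s; exact: lt_nbhsr.
Unshelve. all: by end_near. Qed.

(* d/dt of the Laurent polynomial c0 + c1 t + c2 / t + c3 / t^2. *)
Lemma derive1_laurent (c0 c1 c2 c3 t : R) : t != 0 ->
  derive1 (fun s : R => c0 + c1 * s + c2 * s^-1 + c3 * (s^-1 * s^-1)) t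
    = c1 - c2 / t ^+ 2 - 2 * c3 / t ^+ 3.
Proof.
move=> t0; rewrite derive1E.
pose dV := @is_deriveV R id t 1 1 t0 (is_derive_id t 1).
have H := is_deriveD (is_deriveD (is_deriveD (is_derive_cst c0 t 1)
  (is_deriveM (is_derive_cst c1 t 1) (is_derive_id t 1)))
  (is_deriveM (is_derive_cst c2 t 1) dV))
  (is_deriveM (is_derive_cst c3 t 1) (is_deriveM dV dV)).
rewrite (@derive_val _ _ _ _ _ _ _ H) /= !scaler0 /GRing.scale /=.
by field.
Qed.

Lemma partial0_Phi l p : 0 < p.1 -> 0 < p.2 ->
  partial 0 (Phi l) p
    = 2^-1 * (1 - p.1 ^- 2) + l * (2^-1 * (p.2^-1 - p.2 / p.1 ^+ 2)).
Proof.
case: p => x y /= x0 y0; rewrite /partial eqxx /=.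
have xn : x != 0 by rewrite gt_eqF.
have yn : y != 0 by rewrite gt_eqF.
rewrite (@derive1_near _ (fun s : R => (J y - 1 - l) + (2^-1 + l / (2 * y)) * s
  + (2^-1 + l * y / 2) * s^-1 + 0 * (s^-1 * s^-1)) x x0); last first.
  move=> s s0; have sn : s != 0 by rewrite gt_eqF.
  by rewrite /Phi /J /=; field; rewrite ?xn ?yn ?sn.
by rewrite derive1_laurent //; field; rewrite ?xn ?yn.
Qed.

Lemma partial1_Phi l p : 0 < p.1 -> 0 < p.2 ->
  partial 1 (Phi l) p
    = 2^-1 * (1 - p.2 ^- 2) + l * (2^-1 * (p.1^-1 - p.1 / p.2 ^+ 2)).
Proof.
case: p => x y /= x0 y0; rewrite /partial /=.
have xn : x != 0 by rewrite gt_eqF.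
have yn : y != 0 by rewrite gt_eqF.
rewrite (@derive1_near _ (fun s : R => (J x - 1 - l) + (2^-1 + l / (2 * x)) * s
  + (2^-1 + l * x / 2) * s^-1 + 0 * (s^-1 * s^-1)) y y0); last first.
  move=> s s0; have sn : s != 0 by rewrite gt_eqF.
  by rewrite /Phi /J /=; field; rewrite ?xn ?yn ?sn.
by rewrite derive1_laurent //; field; rewrite ?xn ?yn.
Qed.

Lemma hE l p : 0 < p.1 -> 0 < p.2 -> h l p = h_explicit l p.
Proof.
case: p => x y /= x0 y0.
have xn : x != 0 by rewrite gt_eqF.
have yn : y != 0 by rewrite gt_eqF.
apply/matrixP => i j; rewrite !mxE.
have ord2 (k : 'I_2) : k = if k == 0 then 0 else 1.
  by case: k => [[|[|//]] ?]; apply/val_inj.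
rewrite (ord2 i) (ord2 j); do 2 case: ifP => _; rewrite {1}/partial /=.
- rewrite (@derive1_near _ (fun s : R => (2^-1 + l / (2 * y)) + 0 * s
    + 0 * s^-1 + (- 2^-1 - l * y / 2) * (s^-1 * s^-1)) x x0); last first.
    move=> s s0; have sn : s != 0 by rewrite gt_eqF.
    by rewrite partial0_Phi //=; field; rewrite ?xn ?yn ?sn.
  by rewrite derive1_laurent //; field; rewrite ?xn ?yn.
- rewrite (@derive1_near _ (fun s : R => (2^-1 - 2^-1 * y ^- 2)
    + (- l / 2 * y ^- 2) * s + (l / 2) * s^-1 + 0 * (s^-1 * s^-1)) x x0);
    last first.
    move=> s s0; have sn : s != 0 by rewrite gt_eqF.
    by rewrite partial1_Phi //=; field; rewrite ?xn ?yn ?sn.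
  by rewrite derive1_laurent //; field; rewrite ?xn ?yn.
- rewrite (@derive1_near _ (fun s : R => (2^-1 - 2^-1 * x ^- 2)
    + (- l / 2 * x ^- 2) * s + (l / 2) * s^-1 + 0 * (s^-1 * s^-1)) y y0);
    last first.
    move=> s s0; have sn : s != 0 by rewrite gt_eqF.
    by rewrite partial0_Phi //=; field; rewrite ?xn ?yn ?sn.
  by rewrite derive1_laurent //; field; rewrite ?xn ?yn.
- rewrite (@derive1_near _ (fun s : R => (2^-1 + l / (2 * x)) + 0 * s
    + 0 * s^-1 + (- 2^-1 - l * x / 2) * (s^-1 * s^-1)) y y0); last first.
    move=> s s0; have sn : s != 0 by rewrite gt_eqF.
    by rewrite partial1_Phi //=; field; rewrite ?xn ?yn ?sn.
  by rewrite derive1_laurent //; field; rewrite ?xn ?yn.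
Qed.

Lemma h_sym l p : 0 < p.1 -> 0 < p.2 -> (h l p)^T = h l p.
Proof.
move=> x0 y0; rewrite hE //; case: p {x0 y0} => x y.
by apply/matrixP => i j; rewrite !mxE; do 2 case: ifP.
Qed.

Lemma gtilde_sym p : (gtilde p)^T = gtilde p.
Proof. by rewrite /gtilde linearZ /= trmx_mul trmxK. Qed.

Lemma pairing_inj w w' : (forall X, pairing w X = pairing w' X) -> w = w'.
Proof.
move=> ww'; apply/rowP => i; have := ww' (delta_mx i 0).
by rewrite /pairing -!colE !mxE.
Qed.

Lemma bilin_inj B B' : (forall X Y, bilin B X Y = bilin B' X Y) -> B = B'.
Proof.
move=> BB'; apply/row_matrixP => i; apply: pairing_inj => Y.
by have := BB' (delta_mx i 0) Y; rewrite /bilin /pairing trmx_delta !rowE.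
Qed.

Lemma A_defining l p (B : 'M[R]_2) : 0 < p.1 -> 0 < p.2 -> \det (h l p) != 0 ->
  (forall X Y, bilin (h l p) (B *m X) Y = bilin (gtilde p) X Y) <-> B = A l p.
Proof.
move=> x0 y0 hn.
have hu : h l p \in unitmx by rewrite unitmxE unitfE.
have E X Y : bilin (h l p) (B *m X) Y = bilin (h l p *m B)^T X Y.
  by rewrite /bilin !trmx_mul h_sym // !mulmxA.
split=> [H|->].
  suff e : h l p *m B = gtilde p by rewrite /A -e mulKmx.
  by apply: trmx_inj; rewrite gtilde_sym; apply: bilin_inj => X Y; rewrite -E H.
move=> X Y; rewrite /bilin /A !trmx_mul trmx_inv h_sym // gtilde_sym.
by rewrite -!mulmxA mulKmx.
Qed.

Lemma V_defining l p (W : 'cV[R]_2) : 0 < p.1 -> 0 < p.2 -> \det (h l p) != 0 ->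
  (forall X, bilin (h l p) W X = pairing (omega p) X) <-> W = V l p.
Proof.
move=> x0 y0 hn.
have hu : h l p \in unitmx by rewrite unitmxE unitfE.
split=> [H|->].
  suff e : h l p *m W = (omega p)^T by rewrite /V -e mulKmx.
  apply: trmx_inj; rewrite trmxK trmx_mul h_sym //.
  by apply: pairing_inj => X; rewrite -H.
move=> X; rewrite /bilin /V !trmx_mul trmx_inv h_sym // trmxK.
by rewrite mulmxKV.
Qed.

End Tensors.

(* Main.v *)
Require Import Defs.
From HB Require Import structures.
From mathcomp Require Import all_boot all_order all_algebra.
From mathcomp Require Import all_classical all_reals all_analysis.
From mathcomp Require Import ring.

Import Order.TTheory GRing.Theory Num.Theory.
Import numFieldNormedType.Exports.

Local Open Scope classical_set_scope.
Local Open Scope ring_scope.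

(** Since gtilde = c omega^T omega with c = (x^2 + y^2) / (2 x y), the
    endomorphism A = h^-1 gtilde is c V omega: it has rank at most one, and its
    trace is mu = c omega(V).  Where mu <> 0, dividing by it cancels c and
    leaves P = V omega / omega(V), the projector onto the line of V along
    ker omega ([P_projector], [projector_idem], [limg_projector],
    [lker_projector]).  The kernel of omega = dx / x - dy / y is a line, and it
    contains x d/dx + y d/dy ([lker_omega]).

    The domain is open because it is cut out of the open quadrant by a
    polynomial: solving h V = omega^T by Cramer's rule gives
    omega(V) = (x + y) / (x^3 y^3 det h) ([pairing_VE]), so mu cannot vanish
    where det h does not, while
    4 x^4 y^4 det h = 4 x y (1 + l x) (1 + l y) - l^2 (x^2 + y^2)^2 is a
    polynomial ([det_hE]). *)

Section RankOne.
Context {F : fieldType} {n : nat}.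
Implicit Types (v X : 'cV[F]_n) (w : 'rV[F]_n).

Lemma mulmx_rank1 v w X : v *m w *m X = (w *m X) 0 0 *: v.
Proof. by rewrite -mulmxA [w *m X]mx11_scalar mul_mx_scalar !mxE. Qed.

Definition projector v w : 'M[F]_n := ((w *m v) 0 0)^-1 *: (v *m w).

Lemma projectorE v w X :
  projector v w *m X = ((w *m X) 0 0 / (w *m v) 0 0) *: v.
Proof. by rewrite /projector -scalemxAl mulmx_rank1 scalerA mulrC. Qed.

Context (v : 'cV[F]_n) (w : 'rV[F]_n).
Hypothesis wv0 : (w *m v) 0 0 != 0.

Lemma projector_fix : projector v w *m v = v.
Proof. by rewrite projectorE divff // scale1r. Qed.

Lemma projector_idem : projector v w *m projector v w = projector v w.
Proof. by rewrite {2 3}/projector -scalemxAr mulmxA projector_fix. Qed.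

Lemma limg_projector :
  limg (linfun (mulmx (projector v w) : 'cV[F]_n -> 'cV[F]_n)) = <[v]>%VS.
Proof.
apply/vspaceP => u; apply/memv_imgP/vlineP => [[X _ ->]|[k ->]].
  by rewrite lfunE /= projectorE; eexists.
by exists (k *: v); rewrite ?memvf // lfunE /= -scalemxAr projector_fix.
Qed.

Lemma lker_projector :
  lker (linfun (mulmx (projector v w) : 'cV[F]_n -> 'cV[F]_n))
    = lker (linfun (mulmx w : 'cV[F]_n -> 'cV[F]_1)).
Proof.
have v0 : v != 0 by apply: contraNneq wv0 => ->; rewrite mulmx0 mxE.
apply/vspaceP => X; rewrite !memv_ker !lfunE /= projectorE.
rewrite scaler_eq0 (negPf v0) orbF mulf_eq0 invr_eq0 (negPf wv0) orbF.
apply/eqP/eqP => [e|->]; last by rewrite mxE.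
by rewrite [w *m X]mx11_scalar e raddf0.
Qed.

End RankOne.

Section Projector.
Context {R : realType}.
Implicit Types (l : R) (p : R * R).

Definition detpoly l p : R :=
  4 * p.1 * p.2 * (1 + l * p.1) * (1 + l * p.2)
    - (l * (p.1 ^+ 2 + p.2 ^+ 2)) ^+ 2.

Lemma det_hE l p : 0 < p.1 -> 0 < p.2 ->
  \det (h l p) = detpoly l p / (4 * p.1 ^+ 4 * p.2 ^+ 4).
Proof.
move=> x0 y0; rewrite hE //; case: p x0 y0 => x y /= x0 y0.
have xn : x != 0 by rewrite gt_eqF.
have yn : y != 0 by rewrite gt_eqF.
rewrite (expand_det_row _ 0) !big_ord_recl big_ord0 /cofactor !det_mx11 !mxE.
by rewrite /detpoly /=; field; rewrite xn yn.
Qed.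

(** Cramer's rule for h V = omega^T: the column on the right is
    2 x^3 y^3 adj(h) omega^T, a polynomial in x and y. *)
Lemma VE l p : 0 < p.1 -> 0 < p.2 -> \det (h l p) != 0 ->
  V l p = (2 * p.1 ^+ 3 * p.2 ^+ 3 * \det (h l p))^-1 *:
    vec (p.1 * (2 * p.1 + l * (p.1 ^+ 2 - p.2 ^+ 2)))
        (p.2 * (l * (p.1 ^+ 2 - p.2 ^+ 2) - 2 * p.2)).
Proof.
move=> x0 y0 dn.
have hu : h l p \in unitmx by rewrite unitmxE unitfE.
apply: (can_inj (mulKmx hu)); rewrite /V mulKVmx // -scalemxAr.
have := dn; rewrite det_hE // hE //.
case: p x0 y0 {dn hu} => x y /= x0 y0; rewrite /detpoly /= => dn.
have xn : x != 0 by rewrite gt_eqF.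
have yn : y != 0 by rewrite gt_eqF.
have Dn : 4 * x * y * (1 + l * x) * (1 + l * y)
    - (l * (x ^+ 2 + y ^+ 2)) ^+ 2 != 0.
  by apply: contraNneq dn => ->; rewrite mul0r.
apply/colP => i; rewrite !mxE !big_ord_recl big_ord0 !mxE /=.
by case: ifP => _; field; rewrite xn yn Dn.
Qed.

Lemma pairing_VE l p : 0 < p.1 -> 0 < p.2 -> \det (h l p) != 0 ->
  pairing (omega p) (V l p)
    = (p.1 + p.2) / (p.1 ^+ 3 * p.2 ^+ 3 * \det (h l p)).
Proof.
move=> x0 y0 dn; rewrite VE // /pairing -scalemxAr.
rewrite !mxE !big_ord_recl big_ord0 !mxE /=.
have xn : p.1 != 0 by rewrite gt_eqF.
have yn : p.2 != 0 by rewrite gt_eqF.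
by field; rewrite xn yn dn.
Qed.

Definition gtilde_coef p : R := (p.1 ^+ 2 + p.2 ^+ 2) / (2 * p.1 * p.2).

Lemma gtilde_coef_gt0 p : 0 < p.1 -> 0 < p.2 -> 0 < gtilde_coef p.
Proof. by move=> x0 y0; rewrite divr_gt0 ?addr_gt0 ?mulr_gt0 ?exprn_gt0. Qed.

Lemma A_rank1 l p : A l p = gtilde_coef p *: (V l p *m omega p).
Proof. by rewrite /A /gtilde -scalemxAr mulmxA. Qed.

Lemma muE l p : mu l p = gtilde_coef p * pairing (omega p) (V l p).
Proof. by rewrite /mu A_rank1 mxtraceZ mxtrace_mulC /mxtrace big_ord1. Qed.

Lemma P_projector l p : 0 < p.1 -> 0 < p.2 ->
  P l p = projector (V l p) (omega p).
Proof.
move=> x0 y0; rewrite /P A_rank1 muE scalerA invfM.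
by rewrite mulrAC mulVf ?mul1r // gt_eqF ?gtilde_coef_gt0.
Qed.

Lemma lker_omega p : 0 < p.1 -> 0 < p.2 ->
  lker (linfun (mulmx (omega p) : 'cV[R]_2 -> 'cV[R]_1)) = <[euler p]>%VS.
Proof.
case: p => x y /= x0 y0.
have xn : x != 0 by rewrite gt_eqF.
have yn : y != 0 by rewrite gt_eqF.
apply/vspaceP => X; rewrite memv_ker lfunE /=.
apply/eqP/vlineP => [/(congr1 (fun M : 'cV_1 => M 0 0))|[k ->]].
  rewrite !mxE !big_ord_recl big_ord0 !mxE /= addr0 mulNr => /eqP.
  rewrite subr_eq0 => /eqP e.
  exists (x^-1 * X 0 0); apply/colP => i; rewrite !mxE.
  case: ifP => [/eqP ->|i0]; first by rewrite mulrC mulVKf.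
  rewrite e mulrAC mulVf // mul1r; congr (X _ _).
  by case: i i0 => [[|[|//]] ?] // _; apply/val_inj.
rewrite -scalemxAr; apply/colP => i.
rewrite !mxE !big_ord_recl big_ord0 !mxE /=.
by rewrite addr0 mulNr !mulVf // subrr mulr0.
Qed.

(** By [pairing_VE] the trace is nonzero wherever h is nondegenerate, which
    leaves only the explicit polynomial condition on det h. *)
Lemma domainE l :
  domain l = [set p | 0 < p.1] `&` [set p | 0 < p.2]
    `&` [set p | detpoly l p != 0].
Proof.
apply/seteqP; split=> p /=.
  case=> x0 y0 dn _; split=> //.
  by apply: contraNneq dn; rewrite det_hE // => ->; rewrite mul0r.
case=> -[x0 y0] Dn.
have dn : \det (h l p) != 0.
  by rewrite det_hE // mulf_neq0 // invr_eq0 gt_eqF // !mulr_gt0 ?exprn_gt0.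
split=> //; rewrite muE pairing_VE //.
apply: mulf_neq0; first by rewrite gt_eqF ?gtilde_coef_gt0.
apply: mulf_neq0; first by rewrite gt_eqF ?addr_gt0.
by rewrite invr_eq0 mulf_neq0 // gt_eqF ?mulr_gt0 ?exprn_gt0.
Qed.

Lemma continuous_detpoly l : continuous (detpoly l).
Proof.
move=> p.
have c1 : {for p, continuous (fst : R * R -> R)} by exact: cvg_fst.
have c2 : {for p, continuous (snd : R * R -> R)} by exact: cvg_snd.
have cc (a : R) : {for p, continuous (fun _ : R * R => a)} by exact: cvg_cst.
have cM (f g : R * R -> R) : {for p, continuous f} -> {for p, continuous g} ->
  {for p, continuous (fun q => f q * g q)} by move=> *; exact: cvgM.
have cD (f g : R * R -> R) : {for p, continuous f} -> {for p, continuous g} ->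
  {for p, continuous (fun q => f q + g q)} by move=> *; exact: cvgD.
have cN (f : R * R -> R) : {for p, continuous f} ->
  {for p, continuous (fun q => - f q)} by move=> *; exact: cvgN.
have c2X (f : R * R -> R) : {for p, continuous f} ->
  {for p, continuous (fun q => f q ^+ 2)} by move=> *; exact: cM.
apply: (cD (fun q => 4 * q.1 * q.2 * (1 + l * q.1) * (1 + l * q.2))
  (fun q => - (l * (q.1 ^+ 2 + q.2 ^+ 2)) ^+ 2)).
  apply: (cM _ (fun q => 1 + l * q.2)); last first.
    by apply: (cD _ (fun q => l * q.2)) => //; apply: cM.
  apply: (cM _ (fun q => 1 + l * q.1)); last first.
    by apply: (cD _ (fun q => l * q.1)) => //; apply: cM.
  by apply: (cM _ snd) => //; apply: cM.
apply: (cN (fun q => (l * (q.1 ^+ 2 + q.2 ^+ 2)) ^+ 2)).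
apply: (c2X (fun q => l * (q.1 ^+ 2 + q.2 ^+ 2))).
apply: (cM _ (fun q => q.1 ^+ 2 + q.2 ^+ 2)) => //.
by apply: (cD (fun q => q.1 ^+ 2) (fun q => q.2 ^+ 2)); exact: c2X.
Qed.

Lemma open_domain l : open (domain l).
Proof.
rewrite domainE; apply: openI; first apply: openI.
- apply: (@open_comp _ _ (fst : R * R -> R) [set x | 0 < x]).
    by move=> p _; exact: cvg_fst.
  exact: open_gt.
- apply: (@open_comp _ _ (snd : R * R -> R) [set x | 0 < x]).
    by move=> p _; exact: cvg_snd.
  exact: open_gt.
- apply: (@open_comp _ _ (detpoly l) [set x | x != 0]).
    by move=> p _; exact: continuous_detpoly.
  exact: open_neq.
Qed.

End Projector.

Theorem corollary5p1 (R : realType) (l : R) :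
  open (domain l) /\
  forall p : R * R, domain l p ->
    [/\ P l p *m P l p = P l p,
        pairing (omega p) (V l p) != 0,
        forall X : 'cV[R]_2,
          P l p *m X
            = (pairing (omega p) X / pairing (omega p) (V l p)) *: V l p,
        limg (linfun (mulmx (P l p) : 'cV[R]_2 -> 'cV[R]_2)) = <[V l p]>%VS &
        lker (linfun (mulmx (P l p) : 'cV[R]_2 -> 'cV[R]_2))
            = lker (linfun (mulmx (omega p) : 'cV[R]_2 -> 'cV[R]_1))
        /\ lker (linfun (mulmx (P l p) : 'cV[R]_2 -> 'cV[R]_2))
            = <[euler p]>%VS].
Proof.
split=> [|p [x0 y0 _ mu0]]; first exact: open_domain.
have wV0 : pairing (omega p) (V l p) != 0.
  by apply: contraNneq mu0; rewrite muE => ->; rewrite mulr0.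
rewrite P_projector // lker_projector // lker_omega //.
split=> //; [exact: projector_idem | exact: projectorE | exact: limg_projector].
Qed.
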